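(* Let $G$ be a connected graph and $n\ge 1$. Then B wins the gp achievement game on $G\circ K_n$ if and only if either B wins the gp achievement game on $G$ or $n$ is even.
   Context: A general position set of a graph $G$ is a set $S\subseteq V(G)$ such that no three vertices of $S$ lie on a common shortest path of $G$. The gp achievement game on a graph: players A and B alternately select vertices, A first; a selection is legal if the vertex has not been selected before and the set of all vertices selected so far (including it) is a general position set. The game ends when no legal move exists, and the player who selected the last vertex wins; ''a player wins the game'' means that player has a winning strategy. The lexicographic product $G\circ H$ has vertex set $V(G)\times V(H)$, with $(g,h)$ adjacent to $(g',h')$ iff either $gg'\in E(G)$, or $g=g'$ and $hh'\in E(H)$. $K_n$ is the complete graph on $n$ vertices. *)

(* Defs.v *)
From mathcomp Require Import all_boot.
Set Implicit Arguments.
Unset Strict Implicit.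
Unset Printing Implicit Defensive.

Record sgraph := SGraph {
  vertex :> finType;
  edge : rel vertex;
  edge_sym : symmetric edge;
  edge_irrefl : irreflexive edge }.

Definition connected_graph (G : sgraph) : Prop :=
  0 < #|G| /\ forall x y : G, connect (@edge G) x y.

Section GeneralPosition.
Variable G : sgraph.

(* [x :: p] is a path with the minimum number of edges between its ends. *)
Definition shortest_path (x : G) (p : seq G) : Prop :=
  path (@edge G) x p /\
  forall q : seq G, path (@edge G) x q -> last x q = last x p ->
    size p <= size q.

Definition general_position (S : {set G}) : Prop :=
  forall u v w : G, u \in S -> v \in S -> w \in S ->
    u != v -> u != w -> v != w ->
    ~ exists x p, shortest_path x p /\
        [/\ u \in x :: p, v \in x :: p & w \in x :: p].

End GeneralPosition.

Inductive player := PlayerA | PlayerB.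

Section AchievementGame.
Variable G : sgraph.

(* A position is the sequence of vertices selected so far, oldest first. *)
Definition to_move (h : seq G) : player :=
  if odd (size h) then PlayerB else PlayerA.

Definition legal_move (h : seq G) (v : G) : Prop :=
  v \notin h /\ general_position [set x in rcons h v].

Definition game_over (h : seq G) : Prop := forall v : G, ~ legal_move h v.

Definition selected_last (P : player) (h : seq G) : Prop :=
  exists h' v, h = rcons h' v /\ to_move h' = P.

Inductive play_following (P : player) (sigma : seq G -> G) : seq G -> Prop :=
| play_start : play_following P sigma [::]
| play_step h v :
    play_following P sigma h -> legal_move h v ->
    (to_move h = P -> v = sigma h) ->
    play_following P sigma (rcons h v).

(* The first clause is needed: without it a strategy proposing illegal moves
   would satisfy the second one vacuously. *)
Definition winning_strategy (P : player) (sigma : seq G -> G) : Prop :=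
  forall h, play_following P sigma h ->
    (to_move h = P -> ~ game_over h -> legal_move h (sigma h)) /\
    (game_over h -> selected_last P h).

Definition wins_gp_achievement (P : player) : Prop :=
  exists sigma, winning_strategy P sigma.

End AchievementGame.

Section LexProduct.
Variables G H : sgraph.

Definition lex_edge : rel (G * H) := fun x y =>
  edge x.1 y.1 || (x.1 == y.1) && edge x.2 y.2.

Lemma lex_edge_sym : symmetric lex_edge.
Proof.
by move=> x y; rewrite /lex_edge edge_sym eq_sym (edge_sym x.2 y.2).
Qed.

Lemma lex_edge_irrefl : irreflexive lex_edge.
Proof. by move=> x; rewrite /lex_edge !edge_irrefl andbF. Qed.

Definition lex_product : sgraph := SGraph lex_edge_sym lex_edge_irrefl.

End LexProduct.

Section Complete.
Variable n : nat.

Definition complete_edge : rel 'I_n := fun i j => i != j.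

Lemma complete_edge_sym : symmetric complete_edge.
Proof. by move=> i j; rewrite /complete_edge eq_sym. Qed.

Lemma complete_edge_irrefl : irreflexive complete_edge.
Proof. by move=> i; rewrite /complete_edge eqxx. Qed.

Definition complete_graph : sgraph :=
  SGraph complete_edge_sym complete_edge_irrefl.

End Complete.

(* Main.v *)
Require Import Defs.
From mathcomp Require Import all_boot.

Set Implicit Arguments.
Unset Strict Implicit.
Unset Printing Implicit Defensive.

(** Two vertices of one fibre of [G o K_n] are adjacent twins, so no shortest
    path through both contains a third vertex; hence a set is in general position
    in [G o K_n] iff its projection is in general position in [G].  A player may
    therefore always answer a move inside an already opened fibre by another move
    inside that fibre, as long as parity leaves a vertex there.  If [n] is even,
    B keeps all fibres even and moves last.  If [n] is odd, the positions in
    which every nonempty fibre is odd have the same outcome as their projections,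
    because the second move in an opened fibre can be answered in that fibre. *)

(** * Decidability of shortest paths and general position *)

Section Decidability.
Variable G : sgraph.

Definition shortest_pathb (x : G) (p : seq G) : bool :=
  path (@edge G) x p &&
  [forall k : 'I_(size p), forall q : k.-tuple G,
     path (@edge G) x q ==> (last x q != last x p)].

Lemma shortest_pathP x p : reflect (shortest_path x p) (shortest_pathb x p).
Proof.
apply: (iffP andP) => -[xp min_p]; split=> //.
  move=> q xq lastq; rewrite leqNgt; apply/negP => lt_qp.
  move/forallP/(_ (Ordinal lt_qp))/forallP/(_ (in_tuple q)): min_p.
  by rewrite xq lastq eqxx.
apply/forallP => k; apply/forallP => q; apply/implyP => xq.
apply/eqP => /(min_p _ xq); rewrite size_tuple.
by rewrite leqNgt ltn_ord.
Qed.

(** Cutting out the detours at repeated vertices keeps the ends, so minimality leaves nothing to cut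
    out. *)
Lemma shortest_path_uniq (x : G) p : shortest_path x p -> uniq (x :: p).
Proof.
case=> xp min_p; case/shortenP: xp (min_p) => q xq uq sub_qp /(_ _ xq erefl).
move=> le_pq; apply: (leq_size_uniq uq); last by rewrite /= ltnS.
by move=> z; rewrite !inE => /orP[-> //|/sub_qp->]; rewrite orbT.
Qed.

(** Lengths below [#|G|] suffice because a shortest path repeats no vertex; this makes the search
    finite. *)
Definition general_positionb (S : {set G}) : bool :=
  [forall u in S, forall v in S, forall w in S,
   [&& u != v, u != w & v != w] ==>
   ~~ [exists k : 'I_#|G|, exists x : G, exists p : k.-tuple G,
        [&& shortest_pathb x p, u \in x :: p, v \in x :: p & w \in x :: p]]].

Lemma general_positionP S :
  reflect (general_position S) (general_positionb S).
Proof.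
apply: (iffP idP) => gpS.
  move=> u v w uS vS wS uv uw vw [x [p [xp [up vp wp]]]].
  move/forall_inP/(_ u uS)/forall_inP/(_ v vS)/forall_inP/(_ w wS): gpS.
  rewrite uv uw vw /= => /negP; apply.
  have lt_p : size p < #|G|.
    have /card_uniqP card_xp := shortest_path_uniq xp.
    by rewrite -[size p < _]/(size (x :: p) <= _) -card_xp max_card.
  apply/existsP; exists (Ordinal lt_p); apply/existsP; exists x.
  apply/existsP; exists (in_tuple p); rewrite up vp wp !andbT.
  exact/shortest_pathP.
apply/forall_inP => u uS; apply/forall_inP => v vS; apply/forall_inP => w wS.
apply/implyP => /and3P[uv uw vw]; apply/negP.
case/existsP=> k /existsP[x /existsP[p /and4P[/shortest_pathP xp up vp wp]]].
by apply: (gpS u v w) => //; exists x, p.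
Qed.

End Decidability.

(** * Outcomes by backward induction, and the matching strategies *)

Section Outcome.
Variable G : sgraph.
Implicit Types (S : {set G}) (h : seq G).

Definition legal S (v : G) : bool :=
  (v \notin S) && general_positionb (v |: S).

(* [k] bounds the number of remaining moves. *)
Fixpoint mover_wins_in (k : nat) S : bool :=
  if k is k'.+1 then
    [exists v, legal S v && ~~ mover_wins_in k' (v |: S)]
  else false.

Definition mover_wins S : bool := mover_wins_in #|~: S| S.

Lemma card_setCU1 S (v : G) : v \notin S -> #|~: S| = #|~: (v |: S)|.+1.
Proof.
move=> vS; rewrite (cardsD1 v) inE vS add1n; congr _.+1.
by apply: eq_card => z; rewrite !inE negb_or.
Qed.

Lemma mover_winsE S :
  mover_wins S = [exists v, legal S v && ~~ mover_wins (v |: S)].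
Proof.
rewrite /mover_wins; case def_k: #|~: S| => [|k] /=.
  apply/esym/existsP => -[v /andP[/andP[vS _] _]].
  by move: def_k; rewrite (card_setCU1 vS).
apply: eq_existsb => v; case: (boolP (legal S v)) => //= /andP[vS _].
by move: def_k; rewrite (card_setCU1 vS) => -[->].
Qed.

Lemma set_rcons h (v : G) : [set x in rcons h v] = v |: [set x in h].
Proof. by apply/setP => z; rewrite !inE mem_rcons inE. Qed.

Lemma legal_moveP h v :
  reflect (legal_move h v) (legal [set x in h] v).
Proof.
rewrite /legal -set_rcons inE.
by apply: (iffP andP) => -[vh /general_positionP].
Qed.

Lemma set_nil : [set x in [::]] = set0 :> {set G}.
Proof. by apply/setP => z; rewrite !inE. Qed.

Lemma to_moveB h : to_move h = PlayerB <-> odd (size h).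
Proof. by rewrite /to_move; case: odd. Qed.

(** Induction on the number of unselected vertices: [sigma] supplies the move when B is to move, and
    any legal move of A continues a play following [sigma]. *)
Lemma winning_strategyB_outcome sigma h :
  winning_strategy PlayerB sigma -> play_following PlayerB sigma h ->
  mover_wins [set x in h] = odd (size h).
Proof.
move=> win_sigma; move def_k: #|~: [set x in h]| => k.
elim: k h def_k => [|k IHk] h def_k play_h; have [legal_s last_s] := win_sigma h play_h.
  have over_h : game_over h.
    by move=> v /legal_moveP/andP[/card_setCU1]; rewrite def_k.
  have [h' [v [def_h /to_moveB odd_h']]] := last_s over_h.
  rewrite {2}def_h size_rcons /= odd_h' mover_winsE.
  by apply/existsP => -[w /andP[/legal_moveP/over_h]].
have step v : legal_move h v -> (odd (size h) -> v = sigma h) ->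
    mover_wins (v |: [set x in h]) = ~~ odd (size h).
  move=> legal_v def_v; rewrite -set_rcons IHk ?size_rcons //.
    case/legal_moveP/andP: legal_v => /card_setCU1.
    by rewrite def_k set_rcons => -[].
  by apply: play_step => // /to_moveB.
rewrite mover_winsE; case: (boolP (odd (size h))) step => [odd_h|even_h] step.
  (* If the game were over, B would have moved last and [h] would have even length. *)
  have lm : legal_move h (sigma h).
    apply: legal_s; first exact/to_moveB.
    case/last_s=> h' [v [def_h /to_moveB odd_h']].
    by move: odd_h; rewrite def_h size_rcons /= odd_h'.
  by apply/existsP; exists (sigma h); rewrite step // andbT; apply/legal_moveP.
by apply/existsP => -[v /andP[/legal_moveP lm]]; rewrite step.
Qed.

(** The default [x0] is returned only when no move leaves a position lost for the opponent. *)
Definition outcome_strategy (x0 : G) h : G :=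
  odflt x0 [pick v | legal [set x in h] v && ~~ mover_wins (v |: [set x in h])].

Lemma outcome_strategyP x0 h : mover_wins [set x in h] ->
  legal_move h (outcome_strategy x0 h) /\
  ~~ mover_wins (outcome_strategy x0 h |: [set x in h]).
Proof.
rewrite mover_winsE /outcome_strategy; case: pickP => [v /andP[lv nv] _ | no_v].
  by split=> //; apply/legal_moveP.
by case/existsP=> v; rewrite no_v.
Qed.

(** Invariant: B faces won positions and A lost ones. B's choice preserves it, and A cannot break it
    from a lost position. *)
Lemma play_outcome_strategy x0 h :
  ~~ mover_wins set0 -> play_following PlayerB (outcome_strategy x0) h ->
  mover_wins [set x in h] = odd (size h).
Proof.
move=> Bwins; elim=> [|{}h v _ IHh legal_v def_v].
  by rewrite set_nil; apply: negbTE.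
rewrite set_rcons size_rcons /=.
case: (boolP (odd (size h))) IHh def_v => [odd_h | even_h] IHh def_v.
  rewrite def_v; last exact/to_moveB.
  by apply/negbTE; case: (outcome_strategyP x0 IHh).
move: IHh; rewrite mover_winsE => /existsP no_v.
by apply/idPn => nv; apply: no_v; exists v; rewrite nv andbT; apply/legal_moveP.
Qed.

Lemma general_position1 (x : G) : general_position [set x].
Proof. by move=> u v w /set1P-> /set1P->; rewrite eqxx. Qed.

Lemma wins_gp_achievementB :
  0 < #|G| -> wins_gp_achievement G PlayerB <-> ~~ mover_wins set0.
Proof.
move=> G_gt0; split=> [[sigma win_sigma] | Bwins].
  rewrite -set_nil (winning_strategyB_outcome win_sigma) //.
  exact: play_start.
have /card_gt0P[x0 _] := G_gt0.
exists (outcome_strategy x0) => h play_h.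
have val_h := play_outcome_strategy Bwins play_h.
split=> [/to_moveB odd_h _ | over_h].
  by rewrite odd_h in val_h; case: (outcome_strategyP x0 val_h).
(* The empty history is not final, since any single vertex is a legal first move. *)
case/lastP: h over_h val_h {play_h} => [over _ | h v over_h val_h].
  case: (over x0); apply/legal_moveP; rewrite /legal set_nil setU0 inE.
  exact/general_positionP/general_position1.
exists h, v; split=> //; apply/to_moveB.
(* Had A moved last, the invariant would give B a winning move, so the game would not be over. *)
rewrite size_rcons /= in val_h; apply: contraTT isT => even_h.
move: val_h; rewrite even_h mover_winsE => /existsP[w /andP[/legal_moveP lw _]].
by case: (over_h w).
Qed.

End Outcome.

(** * Shortest paths and general position in the product *)

Section LexComplete.
Variables (G : sgraph) (n : nat).
Local Notation K := (complete_graph n).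
Local Notation L := (lex_product G K).
Implicit Types (x y : L) (p : seq L) (S : {set L}).

Lemma lex_path_lift x p :
  path (@edge G) x.1 [seq z.1 | z <- p] -> path (@edge L) x p.
Proof.
rewrite path_map; apply: sub_path => a b /= ab.
by rewrite /lex_edge ab.
Qed.

(** The bound involves [maxn 1] because distinct vertices of one fibre are one edge apart although
    the empty path joins their projections. *)
Lemma lex_path_lift_ends x y (q : seq G) :
  path (@edge G) x.1 q -> last x.1 q = y.1 ->
  exists p, [/\ path (@edge L) x p, last x p = y & size p <= maxn 1 (size q)].
Proof.
case/lastP: q => [_ /= eq_xy | q g].
  case: (eqVneq x y) => [-> | neq_xy]; first by exists [::].
  exists [:: y]; split=> //=; rewrite andbT /lex_edge eq_xy eqxx /=.
  apply/orP; right; apply: contraNneq neq_xy => eq2.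
  by case: x y eq_xy eq2 => [a b] [c d] /= -> ->.
rewrite last_rcons => xq def_g.
exists (rcons [seq ((z, x.2) : L) | z <- q] y); split.
- apply: lex_path_lift; rewrite map_rcons -map_comp /=.
  by rewrite (eq_map (_ : _ =1 id)) // map_id -def_g.
- by rewrite last_rcons.
by rewrite !size_rcons size_map leq_maxr.
Qed.

(** Edges inside a fibre are dropped, so [q] is either the vertexwise image or strictly shorter than
    [p]. *)
Lemma lex_path_proj x p : path (@edge L) x p ->
  exists q, [/\ path (@edge G) x.1 q, last x.1 q = (last x p).1 &
                q = [seq z.1 | z <- p] \/ size q < size p].
Proof.
elim: p x => [|y p IHp] x /=; first by exists [::]; split=> //; left.
case/andP=> xy /IHp[q [yq lastq size_q]]; case/orP: xy => [xy | /andP[/eqP eq1 _]].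
  exists (y.1 :: q); rewrite /= xy; split=> //.
  by case: size_q => [->|]; [left | right].
exists q; rewrite eq1; split=> //; right; rewrite ltnS.
by case: size_q => [->|/ltnW]; rewrite ?size_map.
Qed.

(** The bound [1 < size p] excludes a single edge inside a fibre, whose projection repeats a
    vertex. *)
Lemma shortest_path_lex_proj x p : 1 < size p ->
  shortest_path x p -> shortest_path x.1 [seq z.1 | z <- p].
Proof.
move=> p_gt1 [xp min_p].
have min_proj q : path (@edge G) x.1 q -> last x.1 q = (last x p).1 ->
    size p <= size q.
  move=> xq /(lex_path_lift_ends xq)[p' [xp' /(min_p _ xp') le_pp' le_p'q]].
  have := leq_trans le_pp' le_p'q.
  by rewrite leq_max leqNgt p_gt1.
have [q [xq lastq size_q]] := lex_path_proj xp.
case: size_q => [def_q | ]; last by rewrite ltnNge min_proj.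
rewrite -def_q; split=> // r xr; rewrite lastq => /(min_proj _ xr).
by rewrite def_q size_map.
Qed.

(** Every competing path in [L] projects to one that is no longer. *)
Lemma shortest_path_lex_lift x p :
  shortest_path x.1 [seq z.1 | z <- p] -> shortest_path x p.
Proof.
case=> xp min_p; split=> [|r xr lastr]; first exact: lex_path_lift.
have [q [xq lastq size_q]] := lex_path_proj xr.
have := min_p q xq; rewrite lastq lastr last_map size_map => /(_ erefl) le_pq.
apply: leq_trans le_pq _.
by case: size_q => [->|/ltnW]; rewrite ?size_map.
Qed.

(** A shortest path of [G] lifts along any section of the projection. Conversely, a path through
    three distinct vertices has at least two edges, so a shortest one projects to a shortest
    path. *)
Lemma general_position_lex S :
  general_position S <-> general_position [set z.1 | z in S].
Proof.
split=> gpS.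
  move=> _ _ _ /imsetP[u uS ->] /imsetP[v vS ->] /imsetP[w wS ->] uv uw vw.
  case=> x [p [xp [up vp wp]]].
  (* a section of the projection through [u], [v] and [w] *)
  pose f (z : G) : L := if z == u.1 then u else
    if z == v.1 then v else if z == w.1 then w else (z, u.2).
  have f1 z : (f z).1 = z.
    by rewrite /f; do 3![case: eqP => // _].
  have fu : f u.1 = u by rewrite /f eqxx.
  have fv : f v.1 = v by rewrite /f eq_sym (negbTE uv) eqxx.
  have fw : f w.1 = w.
    by rewrite /f eq_sym (negbTE uw) (eq_sym w.1) (negbTE vw) eqxx.
  apply: (gpS u v w) => //.
  - by apply: contraNneq uv => ->.
  - by apply: contraNneq uw => ->.
  - by apply: contraNneq vw => ->.
  exists (f x), (map f p); split.
    apply: shortest_path_lex_lift; rewrite f1 -map_comp.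
    by rewrite (eq_map (_ : _ =1 id)) ?map_id // => z /=; rewrite f1.
  by rewrite -map_cons -{1}fu -{1}fv -{1}fw; split; apply: map_f.
move=> u v w uS vS wS uv uw vw [x [p [xp [up vp wp]]]].
have p_gt1 : 1 < size p.
  have uvw : uniq [:: u; v; w] by rewrite /= !inE negb_or uv uw vw.
  apply: (@uniq_leq_size _ _ (x :: p)) uvw _ => z.
  by rewrite !inE => /or3P[] /eqP->.
have xp1 := shortest_path_lex_proj p_gt1 xp.
(* The projected path is shortest, hence free of repetitions, so the path meets each fibre at most
   once. *)
have inj1 a b : a \in x :: p -> b \in x :: p -> a != b -> a.1 != b.1.
  move=> ap bp; apply: contraNneq => eq_ab; apply/eqP.
  have := shortest_path_uniq xp1; rewrite -map_cons => /nth_uniq nth1.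
  move: ap bp => /(nthP x)[i lt_i def_a] /(nthP x)[j lt_j def_b].
  have := nth1 x.1 i j; rewrite !size_map => /(_ lt_i lt_j).
  rewrite !(nth_map x) // def_a def_b eq_ab eqxx => /esym/eqP eq_ij.
  by rewrite -def_a -def_b eq_ij.
apply: (gpS u.1 v.1 w.1); rewrite ?inj1 //; try exact: imset_f.
by exists x.1, [seq z.1 | z <- p]; rewrite -map_cons; split=> //; split; apply: map_f.
Qed.

Lemma general_positionb_lex S :
  general_positionb S = general_positionb [set z.1 | z in S].
Proof. by apply/general_positionP/general_positionP => /general_position_lex. Qed.

(** * Fibre parities and replies inside a fibre *)

Definition fibre_card S (g : G) : nat := #|[set z in S | z.1 == g]|.

Lemma fibre_cardU1 S x g : x \notin S ->
  fibre_card (x |: S) g = (x.1 == g) + fibre_card S g.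
Proof.
move=> xS; rewrite /fibre_card; case: eqP => [eq_g | neq_g].
  rewrite (cardsD1 x) !inE eqxx eq_g eqxx /=; congr (_ + _).
  apply: eq_card => z; rewrite !inE; case: eqVneq => [->|] //=.
  by rewrite (negbTE xS).
apply: eq_card => z; rewrite !inE; case: eqVneq => [->|] //=.
by rewrite (negbTE xS); apply/eqP.
Qed.

Lemma fibre_card_eq0 S g : (fibre_card S g == 0) = (g \notin [set z.1 | z in S]).
Proof.
rewrite cards_eq0; apply/eqP/negP => [S0 /imsetP[x xS def_g] | no_g].
  by have := in_set0 x; rewrite -S0 !inE xS def_g eqxx.
apply/setP => z; rewrite !inE; apply/negP => /andP[zS /eqP def_g].
by apply: no_g; apply/imsetP; exists z.
Qed.

Lemma fibre_card_full S g : (forall i : K, ((g, i) : L) \in S) -> fibre_card S g = n.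
Proof.
move=> full; rewrite /fibre_card.
have -> : [set z in S | z.1 == g] = [set ((g, i) : L) | i : K].
  apply/setP => -[a i]; rewrite !inE /=; apply/andP/imsetP.
    by case=> _ /eqP->; exists i.
  by case=> j _ [-> ->]; rewrite full eqxx.
by rewrite card_imset ?card_ord // => i j [].
Qed.

Lemma imset_fstU1 S x :
  [set z.1 | z in x |: S] = x.1 |: [set z.1 | z in S].
Proof. exact: imsetU1. Qed.

Lemma legal_lex S x :
  legal S x = (x \notin S) && general_positionb (x.1 |: [set z.1 | z in S]).
Proof. by rewrite /legal general_positionb_lex imset_fstU1. Qed.

(** A full fibre has [n] elements, so the parity condition leaves a free vertex beside [x]. Taking
    it keeps the projection, hence is legal, and the two moves cancel modulo two. *)
Lemma fibre_reply S x : legal S x ->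
  odd (fibre_card (x |: S) x.1) != odd n ->
  exists y, [/\ y.1 = x.1, legal (x |: S) y,
                [set z.1 | z in y |: (x |: S)] = x.1 |: [set z.1 | z in S] &
                forall g, odd (fibre_card (y |: (x |: S)) g) = odd (fibre_card S g)].
Proof.
rewrite legal_lex => /andP[xS gpx] parity.
have [i yS | full] := pickP (fun i : K => ((x.1, i) : L) \notin x |: S); last first.
  by case/eqP: parity; rewrite fibre_card_full // => i; apply/idPn; rewrite full.
have proj_y : [set z.1 | z in ((x.1, i) : L) |: (x |: S)] =
              x.1 |: [set z.1 | z in S].
  by rewrite !imset_fstU1 setUA setUid.
exists (x.1, i); split=> //.
  by rewrite /legal yS general_positionb_lex proj_y.
move=> g; rewrite !fibre_cardU1 //= oddD oddD addbA.
by case: (x.1 == g).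
Qed.

Lemma mover_wins_lex_even S : ~~ odd n ->
  (forall g, ~~ odd (fibre_card S g)) -> ~~ mover_wins S.
Proof.
move=> even_n; have [k] := ubnP #|~: S|.
elim: k S => // k IHk S lt_k even_S; rewrite mover_winsE.
apply/existsP => -[x /andP[legal_x /negP]]; apply.
have [xS _] := andP legal_x.
have [|y [_ legal_y _ fib_y]] := fibre_reply legal_x.
  by rewrite fibre_cardU1 // eqxx oddD (negbTE even_n) (negbTE (even_S _)).
rewrite mover_winsE; apply/existsP; exists y; rewrite legal_y /=.
apply: IHk => [|g]; last by rewrite fib_y.
have [yS _] := andP legal_y.
by move: lt_k; rewrite (card_setCU1 xS) (card_setCU1 yS); apply: ltnW.
Qed.

(** Moves opening a fibre match moves in [G]. If a winning move enters an opened fibre, the position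
    after the reply there is still won by the mover and has the same projection. *)
Lemma mover_wins_lex_odd S : odd n ->
  (forall g, g \in [set z.1 | z in S] -> odd (fibre_card S g)) ->
  mover_wins S = mover_wins [set z.1 | z in S].
Proof.
move=> odd_n; have [k] := ubnP #|~: S|.
elim: k S => // k IHk S lt_k odd_S.
(* The newly opened fibre holds one vertex, so the parity condition persists. *)
have step x : x \notin S -> x.1 \notin [set z.1 | z in S] ->
    mover_wins (x |: S) = mover_wins (x.1 |: [set z.1 | z in S]).
  move=> xS x1S; rewrite -imset_fstU1; apply: IHk => [|g].
    by move: lt_k; rewrite (card_setCU1 xS).
  rewrite imset_fstU1 !inE fibre_cardU1 //.
  case: (eqVneq g x.1) => [-> _ | _] /=.
    by move: x1S; rewrite -fibre_card_eq0 => /eqP->.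
  exact: odd_S.
rewrite mover_winsE [RHS]mover_winsE; apply/existsP/existsP.
  case=> x /andP[legal_x lose_x]; have [xS gpx] := andP legal_x.
  case: (boolP (x.1 \in [set z.1 | z in S])) => [x1S | x1S]; last first.
    exists x.1; rewrite -step // lose_x /legal x1S andbT.
    by rewrite -imset_fstU1 -general_positionb_lex.
  have [|y [_ legal_y proj_y fib_y]] := fibre_reply legal_x.
    by rewrite fibre_cardU1 // eqxx oddD odd_S // odd_n.
  have [yS _] := andP legal_y.
  have eqU : x.1 |: [set z.1 | z in S] = [set z.1 | z in S].
    by apply/setUidPr; rewrite sub1set.
  have win_y : mover_wins (y |: (x |: S)).
    move: lose_x; rewrite mover_winsE => /existsP no_y.
    by apply/idPn => ny; apply: no_y; exists y; rewrite legal_y.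
  (* The goal is refolded into the outcome of the projection of [S], which the induction hypothesis
     identifies with the outcome after the reply. *)
  apply/existsP; rewrite -mover_winsE -eqU -proj_y -IHk //.
    by move: lt_k; rewrite (card_setCU1 xS) (card_setCU1 yS); apply: ltnW.
  by move=> g; rewrite proj_y eqU fib_y; apply: odd_S.
case=> g /andP[/andP[gS gpg] lose_g].
have n_gt0 : 0 < n by case: (n) odd_n.
pose x : L := (g, Ordinal n_gt0).
have xS : x \notin S.
  by apply: contraNN gS => xS; apply/imsetP; exists x.
by exists x; rewrite legal_lex xS gpg step.
Qed.

End LexComplete.

Theorem theorem4p3 (G : sgraph) (n : nat) (hG : connected_graph G)
    (hn : 1 <= n) :
  wins_gp_achievement (lex_product G (complete_graph n)) PlayerB <->
  wins_gp_achievement G PlayerB \/ ~~ odd n.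
Proof.
have [G_gt0 _] := hG.
have L_gt0 : 0 < #|lex_product G (complete_graph n)|.
  by rewrite card_prod card_ord muln_gt0 G_gt0.
have [BwinsG GBwins] := wins_gp_achievementB G_gt0.
have [BwinsL LBwins] := wins_gp_achievementB L_gt0.
case: (boolP (odd n)) => [odd_n | even_n].
  (* The empty position has no opened fibre, so the parity condition holds vacuously. *)
  have eqLG : mover_wins (set0 : {set lex_product G (complete_graph n)}) =
              mover_wins (set0 : {set G}).
    by rewrite (mover_wins_lex_odd odd_n) imset0 // => g; rewrite inE.
  split=> [/BwinsL | [/BwinsG | //]]; last by rewrite -eqLG => /LBwins.
  by rewrite eqLG => /GBwins; left.
split=> _; first by right.
apply/LBwins/mover_wins_lex_even => // g.
by rewrite /fibre_card eq_card0 // => z; rewrite !inE.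
Qed.
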